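(* Let $\{(X_i,\mathcal U_i):i\in I\}$ be a family of $g$-quasi uniform spaces with $I\neq\emptyset$, and let $(X,\mathcal U)$ be its product $g$-quasi uniform space. Then $(X,\mathcal U)$ is weak $G$-complete if and only if $(X_i,\mathcal U_i)$ is weak $G$-complete for each $i\in I$.
   Context: A $g$-quasi uniformity (generalized quasi-uniformity) on a nonempty set $Z$ is a nonempty collection $\mathcal V\subset\mathcal P(Z\times Z)$ such that (i) $\Delta(Z)=\{(z,z):z\in Z\}\subset U$ for all $U\in\mathcal V$; (ii) $U\in\mathcal V$ and $U\subset V\subset Z\times Z$ imply $V\in\mathcal V$; (iii) for each $U\in\mathcal V$ there is $V\in\mathcal V$ with $V\circ V\subset U$, where $V\circ V=\{(x,z):\exists y,\ (x,y)\in V,(y,z)\in V\}$. (Closure under intersection is not required.) The pair $(Z,\mathcal V)$ is called a $g$-quasi uniform space. Product: for a family $\{(X_i,\mathcal U_i):i\in I\}$ of $g$-quasi uniform spaces, let $X=\prod_{i\in I}X_i$ with projections $\pi_i:X\to X_i$. The product $g$-quasi uniformity $\mathcal U$ on $X$ is the one with base $\{(\pi_i\times\pi_i)^{-1}(U_i):U_i\in\mathcal U_i,\ i\in I\}$, i.e. $\mathcal U=\{V\subset X\times X: (\pi_i\times\pi_i)^{-1}(U_i)\subset V\text{ for some }i\in I,\ U_i\in\mathcal U_i\}$ (no finite intersections are taken). $(X,\mathcal U)$ is the product $g$-quasi uniform space. For $U\in\mathcal V$ and $x\in Z$ put $U(x)=\{y\in Z:(x,y)\in U\}$. The collection $\mu(\mathcal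 V)=\{G\subset Z: \text{for every }x\in G\text{ there is }U\in\mathcal V\text{ with }U(x)\subset G\}$ is the induced supratopology. A generalized neighborhood of $a\in Z$ is a set $A\subset Z$ with $a\in G\subset A$ for some $G\in\mu(\mathcal V)$. A point $c\in Z$ is a cluster point of a sequence $(x_n)_{n\in\mathbb N}$ in $Z$ if for every generalized neighborhood $A$ of $c$ and every $n\in\mathbb N$ there is $m\ge n$ with $x_m\in A$. The sequence is $G$-Cauchy if for every $U\in\mathcal V$ there is $k\in\mathbb N$ such that $(x_n,x_{n+1})\in U$ for all $n\ge k$. $(Z,\mathcal V)$ is weak $G$-complete if every $G$-Cauchy sequence in $Z$ has a cluster point in $Z$. *)

(* Defs.v *)
From mathcomp Require Import all_boot.
From mathcomp Require Import boolp classical_sets.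

Set Implicit Arguments.
Unset Strict Implicit.
Unset Printing Implicit Defensive.

Local Open Scope classical_set_scope.

Section GQuasiUniform.
Context {Z : Type}.
Implicit Types (V : set_system (Z * Z)) (u : nat -> Z).

Definition is_g_quasi_uniformity V : Prop :=
  [/\ [set: Z] !=set0,
      V !=set0,
      forall U, V U -> diagonal `<=` U,
      forall U W, V U -> U `<=` W -> V W &
      forall U, V U -> exists2 W, V W & (W \; W)%relation `<=` U].

Definition supratopology V : set_system Z :=
  [set G | forall x, G x -> exists2 U, V U & xsection U x `<=` G].

Definition gen_nbhd V (a : Z) (A : set Z) : Prop :=
  exists G, [/\ supratopology V G, G a & G `<=` A].

Definition cluster_point V u (c : Z) : Prop :=
  forall A, gen_nbhd V c A -> forall n, exists2 m, n <= m & A (u m).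

Definition G_Cauchy V u : Prop :=
  forall U, V U -> exists k, forall n, k <= n -> U (u n, u n.+1).

Definition weak_G_complete V : Prop :=
  forall u, G_Cauchy V u -> exists c, cluster_point V u c.

End GQuasiUniform.

(* No finite intersections: each member contains the preimage of a single
   entourage of a single factor. *)
Definition product_gqu (I : Type) (X : I -> Type)
    (V : forall i, set_system (X i * X i)) :
    set_system ((forall i, X i) * (forall i, X i)) :=
  [set W | exists i, exists2 U, V i U & [set p | U (p.1 i, p.2 i)] `<=` W].

Lemma product_gquP (I : Type) (X : I -> Type)
    (V : forall i, set_system (X i * X i)) :
  inhabited I -> (forall i, is_g_quasi_uniformity (V i)) ->
  is_g_quasi_uniformity (product_gqu V).
Proof.
move=> [i0] hV; split.
- have ne i : exists z : X i, True.
    by have [[z _] _ _ _ _] := hV i; exists z.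
  by exists (fun i => projT1 (cid (ne i))).
- have [_ [U VU] _ _ _] := hV i0.
  by exists [set p | U (p.1 i0, p.2 i0)]; exists i0, U.
- move=> W [i [U VU UW]] [f g]; rewrite /diagonal /= => fg; apply: UW => /=.
  by have [_ _ D _ _] := hV i; apply: (D _ VU); rewrite /diagonal /= fg.
- by move=> W W' [i [U VU UW]] WW'; exists i, U => // p /UW /WW'.
- move=> W [i [U VU UW]]; have [_ _ _ _ C] := hV i.
  have [T VT TU] := C _ VU.
  exists [set p | T (p.1 i, p.2 i)]; first by exists i, T.
  move=> [f h] [g /= Tfg Tgh]; apply: UW; apply: TU.
  by exists (g i).
Qed.

(* Main.v *)
Require Import Defs.
From mathcomp Require Import all_boot.
From mathcomp Require Import boolp classical_sets.

(** Projections pull entourages back to entourages and open sets back to open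
sets, so the coordinates of a G-Cauchy sequence are G-Cauchy and the
coordinates of a cluster point are cluster points ([cluster_point_proj]). Hence
completeness of the product descends to a factor once a sequence of that factor
is extended to the product; freezing every other coordinate at a base point
keeps the extension G-Cauchy, since entourages contain the diagonal.

In the other direction, the coordinate sequences of a G-Cauchy sequence have
cluster points, and these assemble to a cluster point of the sequence. In a
product of topologies this can fail, because the coordinates may cluster along
different subsequences; here a basic entourage of the product restricts a
single coordinate, so only one coordinate has to be close at a time. This uses
that the sections [xsection U a] are neighbourhoods of [a]
([xsection_gen_nbhd]). *)

Local Open Scope classical_set_scope.

(** The candidate for the open set inside [xsection U a] consists of the points
having a whole section inside [xsection U a]; it is open because of
entourages [T] with [T \; T] inside a given one. *)
Lemma xsection_gen_nbhd {Z : Type} {V : set_system (Z * Z)} {U : set (Z * Z)}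
    (a : Z) :
  is_g_quasi_uniformity V -> V U -> gen_nbhd V a (xsection U a).
Proof.
move=> [_ _ Vdiag _ Vhalf] VU.
exists [set x | exists2 W, V W & xsection W x `<=` xsection U a]; split.
- move=> x [W VW WU]; have [T VT TTW] := Vhalf W VW.
  exists T => // y /xsectionP Txy; exists T => // z /xsectionP Tyz.
  by apply: WU; apply/xsectionP; apply: TTW; exists y.
- by exists U.
- by move=> x [W VW WU]; apply: WU; apply/xsectionP; apply: (Vdiag W).
Qed.

Lemma supratopology_preimage_proj {I : Type} {X : I -> Type}
    {V : forall i, set_system (X i * X i)} {i : I} {G : set (X i)} :
  supratopology (V i) G ->
  supratopology (product_gqu V) [set f : forall j, X j | G (f i)].
Proof.
move=> oG f Gf; have [U VU UG] := oG _ Gf.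
exists [set p | U (p.1 i, p.2 i)]; first by exists i, U.
by move=> g /xsectionP Ufg; apply: UG; apply/xsectionP.
Qed.

Lemma cluster_point_proj {I : Type} {X : I -> Type}
    {V : forall i, set_system (X i * X i)} {u : nat -> forall i, X i}
    {c : forall i, X i} (i : I) :
  cluster_point (product_gqu V) u c ->
  cluster_point (V i) (fun n => u n i) (c i).
Proof.
move=> uc A [G [oG Gc GA]] n.
have [|m nm Gum] := uc [set f | G (f i)] _ n; last by exists m => //; apply: GA.
by exists [set f | G (f i)]; split=> //; apply: supratopology_preimage_proj.
Qed.

(** A product entourage controls just one coordinate, so a rank
that is good for this coordinate is good for the entourage. *)
Lemma G_Cauchy_product {I : Type} {X : I -> Type}
    {V : forall i, set_system (X i * X i)} {u : nat -> forall i, X i} :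
  G_Cauchy (product_gqu V) u <-> forall i, G_Cauchy (V i) (fun n => u n i).
Proof.
split=> [uC i U VU|uC W [i [U VU UW]]].
  by apply: (uC [set p | U (p.1 i, p.2 i)]); exists i, U.
by have [k uk] := uC i U VU; exists k => n kn; apply: UW; apply: uk.
Qed.

(** For each coordinate separately the points [u n i] cluster at [c i]; a
neighbourhood of [c] contains a cylinder over one coordinate, so it only ever
asks for one of these conditions. *)
Lemma cluster_point_product {I : Type} {X : I -> Type}
    {V : forall i, set_system (X i * X i)} {u : nat -> forall i, X i}
    {c : forall i, X i} :
  (forall i, is_g_quasi_uniformity (V i)) ->
  (forall i, cluster_point (V i) (fun n => u n i) (c i)) ->
  cluster_point (product_gqu V) u c.
Proof.
move=> hV uc A [G [oG Gc GA]] n.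
have [W [i [U VU UW]] WG] := oG c Gc.
have [m nm /xsectionP Um] := uc i _ (xsection_gen_nbhd (c i) (hV i) VU) n.
by exists m => //; apply/GA/WG/xsectionP/UW.
Qed.

(** As [I] is an arbitrary type, indices are compared classically and [x] is
transported along the resulting equality. *)
Definition update_coord {I : Type} {X : I -> Type} (b : forall j, X j) {i : I}
    (x : X i) (j : I) : X j :=
  if pselect (i = j) is left e then eq_rect i X x j e else b j.

Lemma update_coord_same {I : Type} {X : I -> Type} (b : forall j, X j) (i : I)
    (x : X i) : update_coord b x i = x.
Proof.
rewrite /update_coord; case: pselect => // e.
by rewrite (Prop_irrelevance e erefl).
Qed.

Lemma update_coord_neq {I : Type} {X : I -> Type} (b : forall j, X j) (i j : I)
    (x : X i) : i <> j -> update_coord b x j = b j.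
Proof. by rewrite /update_coord; case: pselect. Qed.

Lemma G_Cauchy_cst {Z : Type} {V : set_system (Z * Z)} (a : Z) :
  is_g_quasi_uniformity V -> G_Cauchy V (fun=> a).
Proof. by move=> [_ _ Vdiag _ _] U VU; exists 0 => n _; apply: (Vdiag U). Qed.

Theorem theorem4p10 (I : Type) (X : I -> Type)
    (V : forall i : I, set_system (X i * X i)) :
  inhabited I ->
  (forall i : I, is_g_quasi_uniformity (V i)) ->
  weak_G_complete (product_gqu V) <-> (forall i : I, weak_G_complete (V i)).
Proof.
move=> hI hV; split=> [compl i u uC|compl u /G_Cauchy_product uC].
  have [[b _] _ _ _ _] := product_gquP hI hV.
  pose w n := update_coord b (u n).
  have wi : (fun n => w n i) = u.
    by apply/funext => n; apply: update_coord_same.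
  have /compl[c wc] : G_Cauchy (product_gqu V) w.
    apply/G_Cauchy_product => j; have [<-|ij] := pselect (i = j).
      by rewrite wi.
    have -> : (fun n => w n j) = fun=> b j.
      by apply/funext => n; apply: update_coord_neq.
    exact: G_Cauchy_cst.
  by exists (c i); rewrite -wi; apply: cluster_point_proj.
pose c i := projT1 (cid (compl i _ (uC i))).
exists c; apply: cluster_point_product => // i.
exact: projT2 (cid (compl i _ (uC i))).
Qed.
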